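(* There exist $n$ and a set $\mathcal{S}\subseteq\mathbb{F}_2^n$ such that for every pair of distinct $\alpha,\beta\in\mathcal{S}$ there is an unordered pair $\{\gamma,\delta\}\neq\{\alpha,\beta\}$ of distinct elements of $\mathcal{S}$ with $\gamma+\delta=\alpha+\beta$ (i.e. $|O_{\alpha+\beta}|\ge2$), but $\mathcal{S}$ is not the Fourier support of any Boolean function $f:\mathbb{F}_2^n\to\{-1,1\}$.
   Context: For $\alpha\in\mathbb{F}_2^n$ let $\chi_\alpha(x)=(-1)^{\sum_i\alpha_ix_i}$; every $f:\mathbb{F}_2^n\to\mathbb{R}$ is uniquely $f=\sum_\alpha\widehat f(\alpha)\chi_\alpha$, and its Fourier support is $\{\alpha:\widehat f(\alpha)\ne0\}$. For a set $\mathcal{S}\subseteq\mathbb{F}_2^n$ and $\gamma\in\mathbb{F}_2^n$, $O_\gamma$ denotes the set of unordered pairs of distinct elements of $\mathcal{S}$ summing to $\gamma$. *)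

(* Defs.v *)
From HB Require Import structures.
From mathcomp Require Import all_boot all_order all_algebra.
From mathcomp Require Import boolp reals.

Set Implicit Arguments.
Unset Strict Implicit.
Unset Printing Implicit Defensive.
Import Order.TTheory GRing.Theory Num.Theory.
Local Open Scope ring_scope.

(* The exponent is the F_2-valued inner product, coerced to 0 or 1 in nat. *)
Definition chi (R : realType) (n : nat) (a x : 'rV['F_2]_n) : R :=
  (-1) ^+ (\sum_(i < n) a 0 i * x 0 i : 'F_2)%R.

Lemma signF2D (R : realType) (a b : 'F_2) :
  (-1) ^+ (a + b : 'F_2)%R = (-1) ^+ a * (-1) ^+ b :> R.
Proof.
case: a b => [[|[|i]] lti] [[|[|j]] ltj] //=;
  by rewrite ?(expr0, expr1, mulr1, mul1r, mulrNN).
Qed.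

Lemma chiC (R : realType) (n : nat) (a x : 'rV['F_2]_n) :
  chi R a x = chi R x a.
Proof. by rewrite /chi; under eq_bigr do rewrite mulrC. Qed.

Lemma chiDr (R : realType) (n : nat) (a x y : 'rV['F_2]_n) :
  chi R a (x + y) = chi R a x * chi R a y.
Proof.
rewrite /chi -signF2D -big_split /=; congr (_ ^+ nat_of_ord _).
by apply: eq_bigr => i _; rewrite mxE mulrDr.
Qed.

Lemma chi0 (R : realType) (n : nat) (x : 'rV['F_2]_n) : chi R 0 x = 1.
Proof. by rewrite /chi big1 ?expr0 // => i _; rewrite mxE mul0r. Qed.

Lemma sum_chi (R : realType) (n : nat) (a : 'rV['F_2]_n) :
  \sum_x chi R a x = if a == 0 then 2 ^+ n else 0.
Proof.
case: eqVneq => [->|/rV0Pn[i ai]].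
  under eq_bigr do rewrite chi0.
  by rewrite sumr_const card_mx mul1n card_Fp // natrX.
have chie : chi R a (delta_mx 0 i) = -1.
  have -> : chi R a (delta_mx 0 i) = (-1) ^+ a 0 i.
    congr (_ ^+ nat_of_ord _); rewrite (bigD1 i) // big1 => [|j ji].
      by apply: etrans (addr0 _) _; rewrite mxE !eqxx; apply: mulr1.
    by rewrite mxE (negPf ji) andbF; apply: mulr0.
  by move: ai; case: (a 0 i) => [[|[|m]] ltm] //= _; rewrite expr1.
set s := LHS; have : s = - s.
  rewrite {1}/s (reindex_inj (addIr (delta_mx 0 i))) /= -sumrN.
  by apply: eq_bigr => x _; rewrite chiDr chie mulrN1.
by move/eqP; rewrite -addr_eq0 -mulr2n mulrn_eq0 => /eqP.
Qed.

Lemma F2_rV_opp (n : nat) (x : 'rV['F_2]_n) : - x = x.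
Proof.
apply/rowP => i; rewrite mxE.
by case: (x 0 i) => [[|[|m]] ltm] //; apply: val_inj.
Qed.

Lemma chi_ortho (R : realType) (n : nat) (a b : 'rV['F_2]_n) :
  \sum_x chi R a x * chi R b x = if a == b then 2 ^+ n else 0.
Proof.
under eq_bigr => x _ do rewrite (chiC R a) (chiC R b) -chiDr chiC.
by rewrite sum_chi addr_eq0 F2_rV_opp.
Qed.

Definition fourier_expansion (R : realType) (n : nat)
    (f c : 'rV['F_2]_n -> R) : Prop :=
  forall x, f x = \sum_a c a * chi R a x.

Lemma fourier_expansionE (R : realType) (n : nat) (f c : 'rV['F_2]_n -> R) :
  fourier_expansion f c <->
  forall a, c a = (2 ^+ n)^-1 * \sum_x f x * chi R a x.
Proof.
have n2 : 2 ^+ n != 0 :> R by rewrite expf_neq0 // pnatr_eq0.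
split=> [fc a|cE x].
  under eq_bigr => x _ do rewrite fc mulr_suml.
  rewrite exchange_big /= (bigD1 a) //= [X in _ + X]big1 => [|b ba]; last first.
    under eq_bigr do rewrite -mulrA.
    by rewrite -mulr_sumr chi_ortho (negPf ba) mulr0.
  under eq_bigr do rewrite -mulrA.
  by rewrite addr0 -mulr_sumr chi_ortho eqxx mulrCA mulVf ?mulr1.
under eq_bigr => a _ do rewrite cE -mulrA mulr_suml.
rewrite -mulr_sumr exchange_big /= (bigD1 x) //= [X in _ + X]big1 => [|y yx].
  under eq_bigr => a _ do rewrite -mulrA (chiC _ a x).
  by rewrite addr0 -mulr_sumr chi_ortho eqxx mulrCA mulVf ?mulr1.
under eq_bigr => a _ do rewrite -mulrA (chiC _ a x) (chiC _ a y).
by rewrite -mulr_sumr chi_ortho (negPf yx) mulr0.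
Qed.

Lemma fourier_expansion_exists (R : realType) (n : nat)
    (f : 'rV['F_2]_n -> R) : exists c, fourier_expansion f c.
Proof.
by exists (fun a => (2 ^+ n)^-1 * \sum_x f x * chi R a x);
  apply/fourier_expansionE.
Qed.

Lemma fourier_expansion_unique (R : realType) (n : nat)
    (f c d : 'rV['F_2]_n -> R) :
  fourier_expansion f c -> fourier_expansion f d -> c =1 d.
Proof.
by move=> /fourier_expansionE cE /fourier_expansionE dE a; rewrite cE dE.
Qed.

(* The choice is immaterial by [fourier_expansion_unique]. *)
Definition fourier_coef (R : realType) (n : nat) (f : 'rV['F_2]_n -> R) :
    'rV['F_2]_n -> R :=
  sval (cid (fourier_expansion_exists f)).

Lemma fourier_coefP (R : realType) (n : nat) (f : 'rV['F_2]_n -> R) :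
  fourier_expansion f (fourier_coef f).
Proof. by rewrite /fourier_coef; case: cid. Qed.

Lemma fourier_coefE (R : realType) (n : nat) (f : 'rV['F_2]_n -> R) a :
  fourier_coef f a = (2 ^+ n)^-1 * \sum_x f x * chi R a x.
Proof. by move: a; apply/fourier_expansionE/fourier_coefP. Qed.

Definition fourier_support (R : realType) (n : nat) (f : 'rV['F_2]_n -> R) :
    {set 'rV['F_2]_n} :=
  [set a | fourier_coef f a != 0].

Definition boolean_valued (R : realType) (n : nat) (f : 'rV['F_2]_n -> R) :
    Prop :=
  forall x, f x = -1 \/ f x = 1.

(* The set O_g, an unordered pair of distinct elements being a two-element
   set. *)
Definition pairs_with_sum (n : nat) (S : {set 'rV['F_2]_n})
    (g : 'rV['F_2]_n) : {set {set 'rV['F_2]_n}} :=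
  [set P : {set 'rV['F_2]_n} |
    [&& P \subset S, #|P| == 2 & \sum_(a in P) a == g]].

Lemma pairs_with_sumP (n : nat) (S : {set 'rV['F_2]_n}) (g : 'rV['F_2]_n)
    (P : {set 'rV['F_2]_n}) :
  reflect (exists c d, [/\ c \in S, d \in S, c != d, P = [set c; d] &
                           c + d = g])
          (P \in pairs_with_sum S g).
Proof.
rewrite inE; apply: (iffP and3P) => [[PS /cards2P[c [d [cd PE]]] /eqP sP]|].
  exists c, d; split=> //.
  - by apply: (subsetP PS); rewrite PE set21.
  - by apply: (subsetP PS); rewrite PE set22.
  - by rewrite -sP PE big_setU1 ?inE // big_set1.
move=> [c [d [cS dS cd -> <-]]]; split.
- by rewrite subUset !sub1set cS.
- by rewrite cards2 cd.
- by rewrite big_setU1 ?inE // big_set1.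
Qed.

Lemma pairs_with_sum_gt1 (n : nat) (S : {set 'rV['F_2]_n})
    (a b : 'rV['F_2]_n) :
  a \in S -> b \in S -> a != b ->
  (1 < #|pairs_with_sum S (a + b)|)%N <->
  exists c d, [/\ c \in S, d \in S, c != d, [set c; d] != [set a; b] &
                  c + d = a + b].
Proof.
move=> aS bS ab.
have abO : [set a; b] \in pairs_with_sum S (a + b).
  by apply/pairs_with_sumP; exists a, b.
split=> [|[c [d [cS dS cd cdab cdE]]]].
  rewrite (cardsD1 [set a; b]) abO ltnS card_gt0 => /set0Pn[P].
  rewrite in_setD1 => /andP[PN /pairs_with_sumP[c [d [cS dS cd PE cdE]]]].
  by exists c, d; split=> //; rewrite -PE.
apply/card_gt1P; exists [set c; d], [set a; b]; split=> //.
by apply/pairs_with_sumP; exists c, d.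
Qed.

(* Main.v *)
Require Import Defs.
From mathcomp Require Import all_boot all_order all_algebra.
From mathcomp Require Import boolp reals.
From mathcomp Require Import ring lra.
Import Order.TTheory GRing.Theory Num.Theory.
Local Open Scope ring_scope.

(** The set of all nonzero vectors of F_2^3 works. A Boolean function with this
    support is balanced, which makes its coefficients multiples of 1/2; seven
    nonzero ones have squares summing to at least 7/4, against Parseval. *)

(** Expanding one factor of [f x * f x] and exchanging the sums turns the mean of the square of [f]
    into the sum of squared coefficients; that mean is 1 since [f] takes values -1 and 1. *)
Lemma parseval_boolean (R : realType) (n : nat) (f : 'rV['F_2]_n -> R) :
  boolean_valued f -> \sum_a fourier_coef f a ^+ 2 = 1.
Proof.
move=> fB; have n2 : 2 ^+ n != 0 :> R by rewrite expf_neq0 // pnatr_eq0.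
transitivity ((2 ^+ n)^-1 * \sum_x f x * f x).
  under [in RHS]eq_bigr => x _ do rewrite [in X in _ * X]fourier_coefP mulr_sumr.
  rewrite exchange_big mulr_sumr; apply: eq_bigr => a _.
  under eq_bigr do rewrite mulrCA.
  by rewrite -mulr_sumr mulrCA -fourier_coefE expr2.
under eq_bigr => x _.
  have -> : f x * f x = 1 by case: (fB x) => ->; rewrite ?mulrNN mulr1.
  over.
by rewrite sumr_const card_mx mul1n card_Fp // natrX mulVf.
Qed.

Lemma chi_boolean (R : realType) (n : nat) (a : 'rV['F_2]_n) :
  boolean_valued (chi R a).
Proof. by move=> x; rewrite /chi -signr_odd; case: odd; [left|right]. Qed.

(** Both [f] and [chi R a] sum to zero, so [k] counts the points where both equal -1. For [n = 3],
    dividing by 8 gives a multiple of 1/2. *)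
Lemma balanced_coef_granular (R : realType) (n : nat) (f : 'rV['F_2]_n -> R)
    (a : 'rV['F_2]_n) :
  boolean_valued f -> fourier_coef f 0 = 0 -> a != 0 ->
  exists k : nat, 2 ^+ n * fourier_coef f a = 4 * k%:R - 2 ^+ n.
Proof.
move=> fB f0 a0; have n2 : 2 ^+ n != 0 :> R by rewrite expf_neq0 // pnatr_eq0.
(* The coefficient at 0 is the mean of [f]. *)
have sf : \sum_x f x = 0.
  move/eqP: f0; rewrite fourier_coefE mulf_eq0 invr_eq0 (negPf n2) => /eqP.
  by under eq_bigr do rewrite chi0 mulr1.
exists (\sum_x ((f x == -1)%R && (chi R a x == -1)%R : nat))%N.
(* Sum over [x] of [(1 - f x) * (1 - chi a x)], whose values are 0 and 4. *)
have E x : f x * chi R a x =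
    4 * ((f x == -1) && (chi R a x == -1))%:R - 1 + f x + chi R a x.
  have N1 : (1 == -1 :> R) = false by apply/eqP; lra.
  by case: (fB x) => ->; case: (chi_boolean R n a x) => ->;
    rewrite ?N1 ?eqxx /=; ring.
rewrite fourier_coefE mulVKf // (eq_bigr _ (fun x _ => E x)) !big_split /=.
rewrite sf sum_chi (negPf a0) !addr0 -mulr_sumr natr_sum sumrN.
by rewrite sumr_const card_mx mul1n card_Fp // natrX.
Qed.

(** At least 8 vectors are available, and at most 4 values of [c] must be avoided: [a + b] would
    make [d] zero, while [a] and [b] would give back the same pair. *)
Lemma nonzero_sum_repr (n : nat) (a b : 'rV['F_2]_n) :
  (2 < n)%N -> a != b ->
  exists c d : 'rV['F_2]_n,
    [/\ c != 0, d != 0, c != d, [set c; d] != [set a; b] & c + d = a + b].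
Proof.
move=> n3 ab.
have [c] : exists c, c \in ~: [set:: [:: 0; a; b; a + b]].
  apply/set0Pn; rewrite -card_gt0 cardsCs setCK card_mx mul1n card_Fp // subn_gt0.
  apply: (@leq_trans (2 ^ 3)%N); last by rewrite leq_exp2l.
  by rewrite cardsE; apply: leq_ltn_trans (card_size _) _.
rewrite !inE !negb_or => /and4P[c0 ca cb cab].
exists c, (a + b - c); split=> //; last by rewrite addrC subrK.
- by rewrite subr_eq0 eq_sym.
(* In characteristic 2, [c = d] would force [a + b = c + c = 0], hence [a = b]. *)
- by rewrite eq_sym subr_eq -[X in c + X]F2_rV_opp subrr addr_eq0 F2_rV_opp.
- by apply: contraNneq ca => E; have := set21 c (a + b - c);
    rewrite E !inE (negPf cb) orbF.
Qed.

Theorem theorem5 (R : realType) :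
  exists (n : nat) (S : {set 'rV['F_2]_n}),
    [/\ S != set0,
        forall a b : 'rV['F_2]_n, a \in S -> b \in S -> a != b ->
          exists c d : 'rV['F_2]_n,
            [/\ c \in S, d \in S, c != d, [set c; d] != [set a; b] &
                c + d = a + b]
      & ~ exists f : 'rV['F_2]_n -> R,
            boolean_valued f /\ fourier_support f = S].
Proof.
exists 3%N, [set~ 0]; split.
- by rewrite -card_gt0 cardsC1 card_mx card_Fp.
- move=> a b _ _ /(@nonzero_sum_repr 3 a b isT)[c [d [c0 d0 cd cdab E]]].
  by exists c, d; rewrite !inE.
move=> [f [fB fS]].
have suppE a : (fourier_coef f a != 0) = (a != 0).
  by move/setP/(_ a): fS; rewrite !inE.
have f0 : fourier_coef f 0 = 0.
  by apply/eqP; rewrite -[_ == _]negbK suppE eqxx.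
have coef_ge a : a != 0 -> 4^-1 <= fourier_coef f a ^+ 2.
  move=> a0; have [k] := @balanced_coef_granular R 3 f a fB f0 a0.
  move: (a0); rewrite -suppE; move: (fourier_coef f a) => c c0 ck.
  have {ck} cE : c = (k%:R - 2) / 2 by lra.
  move: c0; rewrite {c}cE.
  (* The values [k = 0, 1] give -1 and -1/2, [k = 2] gives the excluded value 0, and [k >= 3] gives
     at least 1/2. *)
  case: k => [|[|[|k]]]; [|move=> _; nra|by rewrite subrr mul0r eqxx|move=> _].
    by rewrite sub0r; nra.
  have k0 := ler0n R k.
  have -> : k.+3%:R - 2 = k%:R + 1 :> R by rewrite -addn3 natrD; ring.
  by nra.
have := parseval_boolean R 3 f fB.
rewrite (bigD1 0) //= f0 expr0n add0r => P.
have : \sum_(a in [set~ (0 : 'rV['F_2]_3)]) 4^-1 <= 1 :> R.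
  rewrite -[leRHS]P (eq_bigl (fun a => a != 0)) => [|a]; last by rewrite !inE.
  by apply: ler_sum => a; apply: coef_ge.
(* Seven terms 1/4 add up to 7/4, which exceeds 1. *)
rewrite sumr_const cardsC1 card_mx card_Fp // -[X in X <= _]mulr_natr.
by rewrite -[(2 ^ (1 * 3)).-1]/7%N; lra.
Qed.
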